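(* There exists an absolute constant $C$ such that, for any randomized learning algorithm $\mathfrak{A}$ which issues $k$ best-action queries with $k\le T/C$, there is an $n$-armed bandit instance with stochastic i.i.d. rewards in $[0,1]$ on which \[ R_{T,k}(\mathfrak{A})\ \ge\ \Omega\left(\min\left\{\frac{Tn}{k},\ \sqrt{n(T-k)}\right\}\right). \]
   Context: Multi-armed bandits with best-action queries under bandit feedback. There are $n\in\mathbb{N}$ arms and a horizon of $T\in\mathbb{N}$ rounds. At each round $t\in\{1,\dots,T\}$ the environment specifies a reward vector $X_t=(X_{t,1},\dots,X_{t,n})\in[0,1]^n$. In the stochastic i.i.d. setting, each reward $X_{t,i}$ is sampled from a distribution $D_i$ associated with arm $i$, independently across rounds and arms. The learner has a budget of $k\in\{1,\dots,T\}$ best-action queries. At the beginning of each round $t$ it decides whether to query an oracle; it may issue at most $k$ queries in total over the $T$ rounds. - If a query is issued, the oracle reveals a reward-maximizing arm for that round, $i_t^\star\in\arg\max_{i} X_{t,i}$; the learner plays $I_t=i_t^\star$ and observes $X_{t,i_t^\star}$. - Otherwise, the learner selects an arm $I_t\in\{1,\dots,n\}$, possibly at random, and observes only $X_{t,I_t}$. The regret of a learning algorithm $\mathfrak{A}$ is \[ R_{T,k}(\mathfrak{A})=\max_{i\in\{1,\dots,n\}}\sum_{t=1}^T\mathbb{E}[X_{t,i}]-\mathbb{E}\Big[\sum_{t=1}^T X_{t,I_t}\Big], \] with expectation over the randomness of the algorithm and the environment. The notation $\Omega(\cdot)$ hides a positive absolute constant.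
   Formalization: The formal theorem assumes 2 ≤ n ≤ T: for n = 1 the regret is 0 while the bound is positive, and for fixed T and k = 1 the bound grows without limit in n while the regret is at most T. *)

(* Defs.v *)
From HB Require Import structures.
From mathcomp Require Import all_boot all_order all_algebra.
From mathcomp Require Import all_classical all_reals all_analysis.

Set Implicit Arguments.
Unset Strict Implicit.
Unset Printing Implicit Defensive.
Import Order.TTheory GRing.Theory Num.Theory.
Import numFieldNormedType.Exports.
Local Open Scope classical_set_scope.
Local Open Scope ring_scope.

Section product_probability.
Context d (E : measurableType d) (R : realType).

Definition tcons m (x : E * m.-tuple E) : m.+1.-tuple E :=
  [the m.+1.-tuple E of x.1 :: x.2].

Lemma measurable_tcons m : measurable_fun [set: E * m.-tuple E] (@tcons m).
Proof. by apply: measurable_cons; [exact: measurable_fst|exact: measurable_snd]. Qed.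

HB.instance Definition _ m :=
  isMeasurableFun.Build _ _ (E * m.-tuple E)%type (m.+1.-tuple E) (@tcons m)
    (@measurable_tcons m).

(* The product law F_0 (x) ... (x) F_(m-1): under it the coordinates are
   independent and the i-th one has law F i. *)
Fixpoint product_law m : ('I_m -> probability E R) -> probability (m.-tuple E) R :=
  match m with
  | 0 => fun _ => \d_([tuple] : 0.-tuple E)
  | m'.+1 => fun F =>
      distribution (F ord0 \x product_law (fun i => F (lift ord0 i)))%E (@tcons m')
  end.

Lemma product_law_box m (F : 'I_m -> probability E R) (B : 'I_m -> set E) :
  (forall i, measurable (B i)) ->
  product_law F [set x | forall i, B i (tnth x i)] = (\prod_(i < m) F i (B i))%E.
Proof.
elim: m F B => [|m IH] F B mB.
  rewrite big_ord0 /= diracE (_ : _ \in _ = true) //.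
  by apply/mem_set => /= -[].
rewrite big_ord_recl -IH // /= /distribution /pushforward.
rewrite (_ : _ @^-1` _ = B ord0 `*` [set x | forall i, B (lift ord0 i) (tnth x i)]).
  rewrite product_measure1E //.
  rewrite (_ : [set x | _] = \bigcap_(i in [set: 'I_m]) ((fun x => tnth x i) @^-1` B (lift ord0 i))).
    apply: fin_bigcap_measurable; first exact: finite_finset.
    by move=> i _; rewrite -[X in measurable X]setTI; apply: measurable_tnth.
  by apply/seteqP; split=> x /= H i; [move=> _|]; exact: H.
apply/seteqP; split=> -[x y] /=.
  by move=> H; split=> [|i]; [exact: (H ord0)|have := H (lift ord0 i); rewrite tnthS].
move=> [H0 H] i; case: (unliftP ord0 i) => [j ->|->] //.
by rewrite tnthS; exact: H.
Qed.

End product_probability.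

Section bandit_with_queries.
Context (R : realType) (n : nat).

(* X_t *)
Definition rewards := n.-tuple R.

(* What the learner records in one round: whether it queried, the arm it
   played, and the reward of that arm. *)
Definition observation := (bool * 'I_n * R)%type.

(* A randomized algorithm is a random draw (the seed) of a deterministic policy.
   The policy maps the past observations, oldest first, to None (query the
   oracle) or Some i (play arm i); the current round is the length of the past. *)
Record learner := Learner {
  seed_display : measure_display;
  seed : measurableType seed_display;
  seed_law : probability seed R;
  policy : seed -> seq observation -> option 'I_n;
  measurable_policy : forall m (e : m.-tuple (bool * 'I_n)) (a : option 'I_n),
    measurable [set x : seed * m.-tuple R | policy x.1 (zip e x.2) = a]
}.

(* The tie-breaking rule used by the best-action oracle in each round. *)
Record oracle := Oracle {
  best_arm : nat -> rewards -> 'I_n;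
  best_armP : forall t (x : rewards) j, tnth x j <= tnth x (best_arm t x);
  measurable_best_arm : forall t i, measurable [set x : rewards | best_arm t x = i]
}.

Record instance := Instance {
  arm_law : 'I_n -> probability R R;
  arm_law01 : forall i, arm_law i `[0, 1]%classic = 1%E
}.

Section interaction.
Context (A : learner) (O : oracle) (s : seed A).

Definition play_round (h : seq observation) (x : rewards) : seq observation :=
  let a := policy s h in
  let i := if a is Some j then j else best_arm O (size h) x in
  rcons h (a == None, i, tnth x i).

Definition transcript T (X : T.-tuple rewards) : seq observation :=
  foldl play_round [::] X.

Definition total_reward T (X : T.-tuple rewards) : R :=
  \sum_(o <- transcript X) o.2.

Definition num_queries T (X : T.-tuple rewards) : nat :=
  count (fun o => o.1.1) (transcript X).

End interaction.

Definition issues_at_most (A : learner) (T k : nat) : Prop :=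
  forall (O : oracle) (s : seed A) (X : T.-tuple rewards),
    (forall t i, 0 <= tnth (tnth X t) i <= 1) -> (num_queries O s X <= k)%N.

(* Joint law of the seed and of the T x n rewards, all independent. *)
Definition joint_law (A : learner) (D : instance) (T : nat) :
    probability (seed A * T.-tuple rewards)%type R :=
  (seed_law A \x product_law (fun _ : 'I_T => product_law (arm_law D)))%E.

Definition regret (A : learner) (O : oracle) (D : instance) (T : nat) : \bar R :=
  let P := joint_law A D T in
  (\big[maxe/-oo]_(i < n) (\sum_(t < T) 'E_P[fun w => tnth (tnth w.2 t) i])
   - 'E_P[fun w => total_reward O w.1 w.2])%E.

End bandit_with_queries.

(* Main.v *)
(** Arm [i] pays [1 - delta] with probability about [1 - p], plus a tiny bonus
    increasing with [i] that rules out ties; boosting the success probability of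
    one unknown arm [j] by [eps] hides the best arm. Since failures are rare, a
    query gains only about [p] over an ordinary arm. Since ties are broken by
    index, a query answers "the successful arm of largest index", which tests the
    arms from the top down to the first success, hence at most two arms on
    average. So all rounds together test arms [O(T)] times, i.e. some arm only
    [O(T / n)] times, and with [eps] of order [sqrt (p n / T)] the learner cannot
    find [j]: the regret is of order [eps T - p k]. Taking [p] of order
    [min (1, n T / k^2)] makes [p k] negligible and gives the bound.

    The change of measure to the boosted instance uses the likelihood ratio [L]
    of the observed coins only. With [S] the martingale of its increments [x]
    and [Q] the sum of the [x^2], [L >= 1 + S - 2 Q] and [E S^2 = E Q], so no
    bound on second moments of [L] is needed. *)

From HB Require Import structures.
Require Import Defs.
From mathcomp Require Import all_boot all_order all_algebra.
From mathcomp Require Import all_classical all_reals all_analysis.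
From mathcomp Require Import measurable_realfun ring lra.
Import Order.TTheory GRing.Theory Num.Theory.
Import HBNNSimple.
Local Open Scope classical_set_scope.
Local Open Scope ring_scope.

Set Implicit Arguments.
Unset Strict Implicit.
Unset Printing Implicit Defensive.

(** * Finite product laws *)

Section finite_families.
Context (U : finType).

Definition fcons m (a : U) (u : {ffun 'I_m -> U}) : {ffun 'I_m.+1 -> U} :=
  [ffun i => if unlift ord0 i is Some j then u j else a].

Lemma fcons0 m a (u : {ffun 'I_m -> U}) : fcons a u ord0 = a.
Proof. by rewrite ffunE unlift_none. Qed.

Lemma fconsS m a (u : {ffun 'I_m -> U}) i : fcons a u (lift ord0 i) = u i.
Proof. by rewrite ffunE liftK. Qed.

Lemma big_fcons (R : nmodType) m (f : {ffun 'I_m.+1 -> U} -> R) :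
  \sum_u f u = \sum_(a : U) \sum_(u : {ffun 'I_m -> U}) f (fcons a u).
Proof.
rewrite pair_big /= (reindex (fun q : U * {ffun 'I_m -> U} => fcons q.1 q.2)) //=.
exists (fun u => (u ord0, [ffun i => u (lift ord0 i)])) => [[a u] _|u _] /=.
  by rewrite fcons0; congr pair; apply/ffunP => i; rewrite ffunE fconsS.
apply/ffunP => i; case: (unliftP ord0 i) => [j ->|->]; last by rewrite fcons0.
by rewrite fconsS ffunE.
Qed.

Lemma big_ffun0 (R : nmodType) (f : {ffun 'I_0 -> U} -> R) (u0 : {ffun 'I_0 -> U}) :
  \sum_u f u = f u0.
Proof. by rewrite (big_pred1 u0) // => u; apply/esym/eqP/ffunP => -[]. Qed.

Lemma codom_fcons m a (u : {ffun 'I_m -> U}) : codom (fcons a u) = a :: codom u.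
Proof.
rewrite /codom /image_mem !enumT -!enumT enum_ordSl /= fcons0 -map_comp; congr cons.
by apply: eq_map => i /=; rewrite fconsS.
Qed.

Lemma sum_prod_at (R : comNzRingType) (I : finType) (w : I -> U -> R) i (g : U -> R) :
  (forall k, \sum_a w k a = 1) ->
  \sum_(u : {ffun I -> U}) \prod_k w k (u k) * g (u i) = \sum_a w i a * g a.
Proof.
move=> w1; pose F k a := w k a * (if k == i then g a else 1).
transitivity (\sum_(u : {ffun I -> U}) \prod_k F k (u k)).
  apply: eq_bigr => u _; rewrite /F big_split /=; congr (_ * _).
  by rewrite (bigD1 i) //= eqxx big1 ?mulr1 // => k /negPf ->.
rewrite -(bigA_distr_bigA F) (bigD1 i) //= [X in _ * X]big1 ?mulr1.
  by apply: eq_bigr => a _; rewrite /F eqxx.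
by move=> k /negPf ki; rewrite -[RHS](w1 k); apply: eq_bigr => a _; rewrite /F ki mulr1.
Qed.

Context (R : realType).

(** The draws form a list, so that conditioning on the first one ([meanS]) follows the recursion of
    [foldl]. *)
Definition mean (w : U -> R) m (f : seq U -> R) : R :=
  \sum_(u : {ffun 'I_m -> U}) \prod_i w (u i) * f (codom u).

Lemma mean0 w f : mean w 0 f = f [::].
Proof.
have u0 : {ffun 'I_0 -> U} by apply: finfun => -[].
rewrite /mean (big_ffun0 _ u0) big_ord0 mul1r; congr f.
by apply: size0nil; rewrite size_codom card_ord.
Qed.

Lemma meanS w m f : mean w m.+1 f = \sum_a w a * mean w m (fun l => f (a :: l)).
Proof.
rewrite /mean big_fcons; apply: eq_bigr => a _.
rewrite mulr_sumr; apply: eq_bigr => u _.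
rewrite big_ord_recl fcons0 codom_fcons -mulrA; congr (_ * (_ * _)).
by apply: eq_bigr => i _; rewrite fconsS.
Qed.

Lemma eq_mean w m f g : (forall l, size l = m -> f l = g l) -> mean w m f = mean w m g.
Proof.
by move=> fg; apply: eq_bigr => u _; rewrite fg // size_codom card_ord.
Qed.

Lemma meanD w m f g : mean w m (fun l => f l + g l) = mean w m f + mean w m g.
Proof. by rewrite /mean -big_split /=; apply: eq_bigr => u _; rewrite mulrDr. Qed.

Lemma meanZ w m c f : mean w m (fun l => c * f l) = c * mean w m f.
Proof. by rewrite /mean mulr_sumr; apply: eq_bigr => u _; rewrite mulrCA. Qed.

Lemma mean_sum w m (I : finType) (f : I -> seq U -> R) :
  mean w m (fun l => \sum_i f i l) = \sum_i mean w m (f i).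
Proof. by rewrite exchange_big /=; apply: eq_bigr => u _; rewrite mulr_sumr. Qed.

Context (w : U -> R) (w0 : forall a, 0 <= w a) (w1 : \sum_a w a = 1).

Lemma mean_cst m c : mean w m (fun=> c) = c.
Proof.
elim: m => [|m IH]; first by rewrite mean0.
by rewrite meanS IH -mulr_suml w1 mul1r.
Qed.

Lemma le_mean m f g :
  (forall l, size l = m -> f l <= g l) -> mean w m f <= mean w m g.
Proof.
move=> fg; apply: ler_sum => u _; rewrite ler_wpM2l //; first exact: prodr_ge0.
by rewrite fg // size_codom card_ord.
Qed.

End finite_families.

Section discrete_product_law.
Context d (E : measurableType d) (R : realType) (U : finType).

(** A finitely supported law, described by how it integrates nonnegative functions; [v] need not be
    injective, so atoms may coincide. *)
Definition discrete_law (F : probability E R) (w : U -> R) (v : U -> E) :=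
  forall f : E -> R, measurable_fun setT f -> (forall x, 0 <= f x) ->
  (\int[F]_x (f x)%:E = (\sum_u w u * f (v u))%:E)%E.

(** Tonelli splits off the first coordinate; the inner integral is a finite sum by induction, the
    outer one by the hypothesis on [F ord0]. *)
Lemma integral_product_law m (F : 'I_m -> probability E R)
    (w : 'I_m -> U -> R) (v : 'I_m -> U -> E) (f : m.-tuple E -> R) :
  (forall i u, 0 <= w i u) -> (forall i, discrete_law (F i) (w i) (v i)) ->
  measurable_fun setT f -> (forall x, 0 <= f x) ->
  (\int[product_law F]_x (f x)%:E =
  (\sum_(u : {ffun 'I_m -> U}) \prod_i w i (u i) * f [tuple v i (u i) | i < m])%:E)%E.
Proof.
move=> w0 Fw; elim: m F w v f w0 Fw => [|m IH] F w v f w0 Fw mf f0.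
  have u0 : {ffun 'I_0 -> U} by apply: finfun => -[].
  rewrite integral_dirac //; last exact/measurable_EFinP.
  rewrite diracT mul1e (big_ffun0 _ u0) big_ord0 mul1r.
  by congr (f _)%:E; apply: eq_from_tnth => -[].
have mcons : measurable_fun setT (@tcons _ E m) by exact: measurable_tcons.
rewrite /= ge0_integral_distribution //; last exact/measurable_EFinP.
rewrite (fubini_tonelli1 (fun z => (f (tcons z))%:E)) /=; first last.
- by move=> x; rewrite lee_fin.
- by apply/measurable_EFinP; exact: measurableT_comp.
rewrite /fubini_F /=.
pose W (u : {ffun 'I_m -> U}) := \prod_i w (lift ord0 i) (u i).
pose V (u : {ffun 'I_m -> U}) := [tuple v (lift ord0 i) (u i) | i < m].
have W0 u : 0 <= W u by exact: prodr_ge0.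
transitivity (\int[F ord0]_x (\sum_u W u * f (tcons (x, V u)))%:E)%E.
  apply: eq_integral => x _; rewrite (IH _ (fun i => w (lift ord0 i))
    (fun i => v (lift ord0 i)) (fun y => f (tcons (x, y)))) //.
  by apply: measurableT_comp => //; exact: measurableT_comp.
rewrite (Fw ord0); last first.
- by move=> x; apply: sumr_ge0 => u _; exact: mulr_ge0.
- apply: measurable_sum => u; apply: measurable_funM => //.
  by apply: measurableT_comp => //; exact: measurableT_comp.
rewrite big_fcons; congr _%:E; apply: eq_bigr => a _.
rewrite mulr_sumr; apply: eq_bigr => u _.
rewrite big_ord_recl fcons0 -mulrA; congr (_ * (_ * f _)).
  by apply: eq_bigr => i _; rewrite fconsS.
apply: eq_from_tnth => i; rewrite tnth_mktuple.
case: (unliftP ord0 i) => [j ->|->]; last by rewrite fcons0.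
by rewrite fconsS tnthS tnth_mktuple.
Qed.

End discrete_product_law.

(** * Two-point instances *)

Section two_point_laws.
Context (R : realType) (n : nat) (delta : R).

Definition arm_value (i : 'I_n) (c : bool) : R :=
  delta * (i%:R / n%:R) + (1 - delta) * c%:R.

Lemma measurable_arm_value i : measurable_fun [set: bool] (arm_value i).
Proof. by []. Qed.

HB.instance Definition _ i :=
  isMeasurableFun.Build _ _ bool R (arm_value i) (@measurable_arm_value i).

Definition two_point_law (q : 'I_n -> R) (i : 'I_n) : probability R R :=
  distribution (bernoulli_prob (q i)) (arm_value i).

Definition reward_vector (b : {ffun 'I_n -> bool}) : rewards R n :=
  [tuple arm_value i (b i) | i < n].

Definition coins_weight (q : 'I_n -> R) (b : {ffun 'I_n -> bool}) : R :=
  \prod_i bernoulli_pmf (q i) (b i).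

Hypothesis delta01 : 0 <= delta <= 1.

Lemma arm_value01 i c : 0 <= arm_value i c <= 1.
Proof.
have n0 : 0 < n%:R :> R by rewrite ltr0n (leq_ltn_trans _ (ltn_ord i)).
have i0 : 0 <= i%:R / n%:R :> R by rewrite divr_ge0.
have i1 : i%:R / n%:R <= 1 :> R by rewrite ler_pdivrMr // mul1r ler_nat ltnW.
move: delta01; rewrite /arm_value; case: c => /=; nra.
Qed.

Lemma two_point_law01 q i : two_point_law q i `[0, 1]%classic = 1%E.
Proof.
rewrite -(probability_setT (bernoulli_prob (q i))); congr (bernoulli_prob _ _).
by apply/seteqP; split=> c //= _; rewrite in_itv /= arm_value01.
Qed.

Definition two_point_instance q : instance R n :=
  Instance (fun i => two_point_law01 q i).

Context (q : 'I_n -> R) (q01 : forall i, 0 <= q i <= 1).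

Lemma two_point_discrete i :
  discrete_law (two_point_law q i) (bernoulli_pmf (q i)) (arm_value i).
Proof.
move=> f mf f0; rewrite ge0_integral_distribution //; last exact/measurable_EFinP.
rewrite integral_bernoulli_prob //; last by move=> c; rewrite lee_fin.
by rewrite big_bool.
Qed.

Lemma coins_weight_ge0 b : 0 <= coins_weight q b.
Proof. by apply: prodr_ge0 => i _; exact: bernoulli_pmf_ge0. Qed.

Lemma coins_weight_sum : \sum_b coins_weight q b = 1.
Proof.
rewrite /coins_weight -(bigA_distr_bigA (fun i c => bernoulli_pmf (q i) c)) /=.
by rewrite big1 // => i _; rewrite big_bool /= /bernoulli_pmf /= subrKC.
Qed.

Lemma reward_vector_discrete :
  discrete_law (product_law (arm_law (two_point_instance q)))
    (coins_weight q) reward_vector.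
Proof.
move=> f mf f0; rewrite (integral_product_law (w := fun i => bernoulli_pmf (q i))
  (v := arm_value)) // => i; last exact: two_point_discrete.
by move=> c; exact: bernoulli_pmf_ge0.
Qed.

Context (A : learner R n) (T : nat).

Definition reward_matrix (u : {ffun 'I_T -> {ffun 'I_n -> bool}}) : T.-tuple (rewards R n) :=
  [tuple reward_vector (u t) | t < T].

Definition coins_mean (f : T.-tuple (rewards R n) -> R) : R :=
  \sum_(u : {ffun 'I_T -> {ffun 'I_n -> bool}})
    \prod_t coins_weight q (u t) * f (reward_matrix u).

Local Notation P := (joint_law A (two_point_instance q) T).

Lemma integral_joint_law (f : seed A * T.-tuple (rewards R n) -> R) :
  measurable_fun setT f -> (forall x, 0 <= f x) ->
  (\int[P]_x (f x)%:E = \int[seed_law A]_s (coins_mean (fun X => f (s, X)))%:E)%E.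
Proof.
move=> mf f0; rewrite (fubini_tonelli1 (fun z => (f z)%:E)) /=; first last.
- by move=> x; rewrite lee_fin.
- exact/measurable_EFinP.
apply: eq_integral => s _; rewrite /fubini_F /=.
rewrite (integral_product_law (w := fun=> coins_weight q) (v := fun=> reward_vector)
  (f := fun y => f (s, y))) //.
- by move=> _ b; exact: coins_weight_ge0.
- by move=> _; exact: reward_vector_discrete.
- exact: measurable_fun_pair2.
Qed.

Lemma measurable_coins_mean (f : seed A * T.-tuple (rewards R n) -> R) :
  measurable_fun setT f -> measurable_fun setT (fun s => coins_mean (fun X => f (s, X))).
Proof.
move=> mf; apply: measurable_sum => u; apply: measurable_funM => //.
exact: measurable_fun_pair1.
Qed.

Lemma le_coins_mean (f g : T.-tuple (rewards R n) -> R) :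
  (forall u, f (reward_matrix u) <= g (reward_matrix u)) -> coins_mean f <= coins_mean g.
Proof.
move=> fg; apply: ler_sum => u _; rewrite ler_wpM2l //.
by apply: prodr_ge0 => t _; exact: coins_weight_ge0.
Qed.

(* The integral of a nonnegative function is by definition a supremum over the
   simple functions below it, so [f] itself need not be measurable. *)
Lemma expectation_joint_law_le (f : seed A * T.-tuple (rewards R n) -> R) (B : R) :
  (forall s u, 0 <= f (s, reward_matrix u)) ->
  (forall g : seed A -> R, measurable_fun setT g -> (forall s, 0 <= g s) ->
    (forall s, g s <= coins_mean (fun X => f (s, X))) ->
    (\int[seed_law A]_s (g s)%:E <= B%:E)%E) ->
  ('E_P[f] <= B%:E)%E.
Proof.
move=> f0 fB; rewrite unlock integralE.
apply: (@le_trans _ _ (\int[P]_x ((fun x => (f x)%:E) ^\+ x))%E).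
  by rewrite -[leRHS]sube0; apply: leeB => //; exact: integral_ge0.
rewrite ge0_integralTE //; apply: ge_ereal_sup => _ /= [h hf <-].
have mh : measurable_fun setT h by exact: measurable_funPT.
(* The simple minorant [h] is measurable, so Tonelli applies to it and its mean over the coins is an
   admissible [g]. *)
rewrite -integralT_nnsfun integral_joint_law //.
apply: fB.
- exact: measurable_coins_mean.
- move=> s; apply: sumr_ge0 => u _; apply: mulr_ge0 => //.
  by apply: prodr_ge0 => t _; exact: coins_weight_ge0.
- move=> s; apply: le_coins_mean => u.
  have := hf (s, reward_matrix u).
  by rewrite funeposE -EFin_max lee_fin (max_idPl _).
Qed.

(** The sign of [f] is known only on the values of [reward_matrix]. The law charges no other
    rewards, so the negative part integrates to zero. *)
Lemma expectation_joint_law (f : seed A * T.-tuple (rewards R n) -> R) :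
  measurable_fun setT f -> (forall s u, 0 <= f (s, reward_matrix u)) ->
  ('E_P[f] = \int[seed_law A]_s (coins_mean (fun X => f (s, X)))%:E)%E.
Proof.
move=> mf f0; rewrite unlock integralE.
have -> : (\int[P]_x ((fun x => (f x)%:E) ^\- x) = 0)%E.
  transitivity (\int[P]_x (Num.max (- f x) 0)%:E)%E.
    by apply: eq_integral => x _; rewrite funenegE -EFinN -EFin_max.
  rewrite (integral_joint_law (f := fun x => Num.max (- f x) 0)); first last.
  - by move=> x; rewrite le_max lexx orbT.
  - by apply: measurable_maxr => //; exact: measurableT_comp.
  apply: integral0_eq => s _; congr _%:E; apply: big1 => u _.
  by rewrite (max_idPr _) ?mulr0 // oppr_le0.
rewrite sube0; transitivity (\int[P]_x (Num.max (f x) 0)%:E)%E.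
  by apply: eq_integral => x _; rewrite funeposE -EFin_max.
rewrite (integral_joint_law (f := fun x => Num.max (f x) 0)); first last.
- by move=> x; rewrite le_max lexx orbT.
- exact: measurable_maxr.
by apply: eq_integral => s _; congr _%:E; apply: eq_bigr => u _; rewrite (max_idPl _).
Qed.

End two_point_laws.

(** * Coins and the oracle *)

Section coins.
Context (n : nat).
Local Notation coins := {ffun 'I_n -> bool}.

Definition flip (j : 'I_n) (b : coins) : coins := [ffun i => b i (+) (i == j)].

Lemma flipK j : involutive (flip j).
Proof. by move=> b; apply/ffunP => i; rewrite !ffunE -addbA addbb addbF. Qed.

Lemma flip_at j b : flip j b j = ~~ b j.
Proof. by rewrite ffunE eqxx addbT. Qed.

Lemma flip_neq j b i : i != j -> flip j b i = b i.
Proof. by move=> /negPf ij; rewrite ffunE ij addbF. Qed.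

Context (R : realType).

Lemma coins_weight_at (q : 'I_n -> R) i (g : bool -> R) :
  \sum_b coins_weight q b * g (b i) = q i * g true + (1 - q i) * g false.
Proof.
rewrite /coins_weight (sum_prod_at (w := fun k => bernoulli_pmf (q k)) i g).
  by rewrite big_bool.
by move=> k; rewrite big_bool /bernoulli_pmf /= subrKC.
Qed.

(** Independence of coin [j] from the others: a centred function of it is orthogonal to any [H] that
    ignores it. The one-round identities for the likelihood ratio come from this. *)
Lemma coins_weight_flip_sum (q : 'I_n -> R) j (y : bool -> R) (H : coins -> R) :
  q j * y true + (1 - q j) * y false = 0 -> (forall b, H (flip j b) = H b) ->
  \sum_b coins_weight q b * (y (b j) * H b) = 0.
Proof.
move=> y0 Hf; set S := \sum_b _; suff : S = - S by lra.
(* the terms of [b] and [flip j b] cancel *)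
rewrite {1}/S (reindex_inj (can_inj (flipK j))) -sumrN; apply: eq_bigr => b _.
rewrite Hf flip_at /coins_weight [in LHS](bigD1 j) //= [in RHS](bigD1 j) //= flip_at.
rewrite (eq_bigr (fun i => bernoulli_pmf (q i) (b i))); last first.
  by move=> i ij; rewrite flip_neq.
set V := \prod_(_ | _) _.
have -> : - (bernoulli_pmf (q j) (b j) * V * (y (b j) * H b)) =
   - (bernoulli_pmf (q j) (b j) * y (b j)) * (V * H b) by ring.
have -> : bernoulli_pmf (q j) (~~ b j) * V * (y (~~ b j) * H b) =
   (bernoulli_pmf (q j) (~~ b j) * y (~~ b j)) * (V * H b) by ring.
by congr (_ * _); case: (b j) => /=; rewrite /bernoulli_pmf; lra.
Qed.

Lemma sum_at_most_one (P : pred 'I_n) :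
  (forall i j, P i -> P j -> i = j) -> \sum_i (P i)%:R <= 1 :> R.
Proof.
move=> uP; case: (pickP P) => [i Pi|P0].
  rewrite (bigD1 i) //= Pi big1 ?addr0 // => j ji.
  by case Pj : (P j) => //; rewrite (uP _ _ Pj Pi) eqxx in ji.
by rewrite big1 // => i _; rewrite P0.
Qed.

End coins.

Section arm_values.
Context (R : realType) (n : nat) (delta : R).
Hypothesis delta_gt0 : 0 < delta.
Hypothesis delta_le : delta <= 1 / 2.

Let ratio_bound (i : 'I_n) : 0 <= (i%:R / n%:R : R) < 1.
Proof.
have n0 : (0 < n)%N by exact: leq_ltn_trans (ltn_ord i).
by rewrite divr_ge0 //= ltr_pdivrMr ?ltr0n // mul1r ltr_nat.
Qed.

(** The bonus stays below [delta], whereas a success adds [1 - delta], which is at least [delta]. *)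
Lemma arm_value_lt_success (i j : 'I_n) : arm_value delta j false < arm_value delta i true.
Proof.
move: (ratio_bound i) (ratio_bound j) delta_gt0 delta_le.
rewrite /arm_value /=; set u := _ / _; set v := _ / _; nra.
Qed.

Lemma arm_value_lt (i j : 'I_n) c : (j < i)%N -> arm_value delta j c < arm_value delta i c.
Proof.
move=> ji; rewrite /arm_value ltrD2r ltr_pM2l // ltr_pM2r ?ltr_nat //.
by rewrite invr_gt0 ltr0n; exact: leq_ltn_trans (ltn_ord i).
Qed.

Lemma arm_value_inj (i j : 'I_n) c c' : arm_value delta i c = arm_value delta j c' -> i = j.
Proof.
have [->//|neq] := eqVneq c c'.
  move=> e; apply/eqP/contraT; rewrite -val_eqE neq_ltn => /orP[] /(@arm_value_lt _ _ c').
    by rewrite e ltxx.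
  by rewrite e ltxx.
by case: c c' neq => -[] // _ e; [have := arm_value_lt_success i j|have := arm_value_lt_success j i];
  rewrite e ltxx.
Qed.

Lemma arm_value_le (i : 'I_n) c : arm_value delta i c <= delta + c%:R.
Proof.
move: (ratio_bound i) delta_gt0 delta_le.
by rewrite /arm_value; set u := _ / _; case: c => /=; nra.
Qed.

Context (O : oracle R n).

Lemma best_arm_neq t (b : {ffun 'I_n -> bool}) (i j : 'I_n) :
  (j < i)%N -> b i -> best_arm O t (reward_vector delta b) != j.
Proof.
move=> ji bi; apply/eqP => e.
have := best_armP O t (reward_vector delta b) i; rewrite e !tnth_mktuple bi leNgt.
by case: (b j); rewrite ?arm_value_lt ?arm_value_lt_success.
Qed.

Lemma best_arm_unique t (b : {ffun 'I_n -> bool}) j :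
  (forall i, arm_value delta i (b i) <= arm_value delta j (b j)) ->
  best_arm O t (reward_vector delta b) = j.
Proof.
move=> bj; set k := best_arm O t _.
apply: (@arm_value_inj _ _ (b k) (b j)); apply: le_anti; rewrite bj /=.
by have := best_armP O t (reward_vector delta b) j; rewrite !tnth_mktuple.
Qed.

Lemma best_arm_max t (b : {ffun 'I_n -> bool}) i :
  arm_value delta i (b i) <= arm_value delta (best_arm O t (reward_vector delta b))
                         (b (best_arm O t (reward_vector delta b))).
Proof. by have := best_armP O t (reward_vector delta b) i; rewrite !tnth_mktuple. Qed.

(** Before and after the flip, the success of [i] keeps [j] from being best. The other values are
    unchanged, so the two maximizers have equal values and coincide. *)
Lemma best_arm_flip t (b : {ffun 'I_n -> bool}) (i j : 'I_n) : (j < i)%N -> b i ->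
  best_arm O t (reward_vector delta (flip j b)) = best_arm O t (reward_vector delta b).
Proof.
move=> ji bi; set k := best_arm O t (reward_vector delta b).
have kj : k != j by exact: best_arm_neq bi.
set k' := best_arm O t _.
have k'j : k' != j.
  by apply: (best_arm_neq _ ji); rewrite flip_neq // -val_eqE gtn_eqF.
apply: (@arm_value_inj _ _ (b k') (b k)); apply: le_anti; rewrite best_arm_max /=.
by have := @best_arm_max t (flip j b) k; rewrite -/k' !flip_neq.
Qed.

End arm_values.

(** * The interaction for a fixed seed *)

Section fixed_seed.
Context (R : realType) (n : nat) (A : learner R n) (O : oracle R n) (s : seed A).
Context (delta p eps : R).
Hypothesis delta_gt0 : 0 < delta.
Hypothesis delta_le : delta <= 1 / 2.
Hypothesis p_gt0 : 0 < p.
Hypothesis p_le : p <= 1 / 2.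
Hypothesis eps_ge0 : 0 <= eps.
Hypothesis eps_le : eps <= p / 2.

Local Notation coins := {ffun 'I_n -> bool}.
Local Notation history := (seq (observation R n)).

Definition base : 'I_n -> R := fun=> 1 - p.
Definition boosted (j i : 'I_n) : R := 1 - p + (i == j)%:R * eps.

Local Notation w0 := (coins_weight base).
Local Notation w_ j := (coins_weight (boosted j)).

Lemma base01 i : 0 <= base i <= 1.
Proof. by move: p_gt0 p_le; rewrite /base; lra. Qed.

Lemma boosted01 j i : 0 <= boosted j i <= 1.
Proof. by move: p_gt0 p_le eps_ge0 eps_le; rewrite /boosted; case: eqP => _ /=; lra. Qed.

Let w0_ge0 b : 0 <= w0 b. Proof. exact: coins_weight_ge0 base01 b. Qed.
Let w0_sum : \sum_b w0 b = 1. Proof. exact: coins_weight_sum. Qed.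
Let wj_ge0 j b : 0 <= w_ j b. Proof. exact: coins_weight_ge0 (boosted01 j) b. Qed.
Let wj_sum j : \sum_b w_ j b = 1. Proof. exact: coins_weight_sum. Qed.

Definition step (h : history) (b : coins) : history :=
  play_round O s h (reward_vector delta b).

Definition run (h : history) (l : seq coins) : history := foldl step h l.

Lemma size_run h l : size (run h l) = (size h + size l)%N.
Proof.
elim: l h => [|b l IH] h /=; first by rewrite addn0.
by rewrite IH /step /play_round size_rcons addSnnS.
Qed.

(* An upper bound on the event that the record of the round depends on coin [j]:
   on a query this needs every arm of larger index to fail. *)
Definition observed (j : 'I_n) (h : history) (b : coins) : bool :=
  if policy s h is Some i then i == j else [forall i : 'I_n, (j < i)%N ==> ~~ b i].

(** Whether coin [j] is observed is decided without looking at it, hence independently of its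
    outcome. *)
Lemma observed_flip j h b : observed j h (flip j b) = observed j h b.
Proof.
rewrite /observed; case: (policy s h) => // ; apply: eq_forallb => i.
by case: (ltnP j i) => //= ji; rewrite flip_neq // -val_eqE gtn_eqF.
Qed.

Lemma step_flip j h b : ~~ observed j h b -> step h (flip j b) = step h b.
Proof.
rewrite /observed /step /play_round; case: (policy s h) => [i ij|].
  by rewrite !tnth_mktuple flip_neq.
rewrite negb_forall => /existsP[i]; rewrite negb_imply negbK => /andP[ji bi].
rewrite (best_arm_flip delta_gt0 delta_le _ _ ji bi) !tnth_mktuple flip_neq //.
exact: (best_arm_neq delta_gt0 delta_le _ _ ji bi).
Qed.

(** On a query, an observed success is the successful arm of largest index; otherwise only the
    played arm is observed. *)
Lemma observed_success_unique h (b : coins) i j :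
  b i && observed i h b -> b j && observed j h b -> i = j.
Proof.
rewrite /observed; case: (policy s h) => [k|].
  by move=> /andP[_ /eqP <-] /andP[_ /eqP].
move=> /andP[bi /forallP oi] /andP[bj /forallP oj].
apply/eqP/contraT; rewrite -val_eqE neq_ltn => /orP[] ij.
  by have := oi j; rewrite ij bj.
by have := oj i; rewrite ij bi.
Qed.

(** [1 + excess c] is the ratio of the boosted to the base probability of outcome [c]; [chi2] is the
    base variance of [excess], the chi-squared divergence of the two coins. *)
Definition excess (c : bool) : R := if c then eps / (1 - p) else - (eps / p).
Definition chi2 : R := eps ^+ 2 / (p * (1 - p)).
Definition increment j h (b : coins) : R := (observed j h b)%:R * excess (b j).

Let p1_gt0 : 0 < 1 - p. Proof. by move: p_le; lra. Qed.

Lemma boosted_weight j (b : coins) : w_ j b = w0 b * (1 + excess (b j)).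
Proof.
rewrite /coins_weight (bigD1 j) //= [in RHS](bigD1 j) //= mulrAC; congr (_ * _).
  rewrite /boosted /base eqxx mul1r /bernoulli_pmf /excess.
  by move: p_gt0 p1_gt0; case: (b j) => p0 p1; field; rewrite gt_eqF.
by apply: eq_bigr => i /negPf ij; rewrite /boosted ij mul0r addr0.
Qed.

Lemma excess_mean j : base j * excess true + (1 - base j) * excess false = 0.
Proof.
rewrite /base /excess /=; move: p_gt0 p1_gt0 => p0 p1; field.
by rewrite !gt_eqF.
Qed.

Lemma excess_var j :
  base j * (excess true ^+ 2 - chi2) + (1 - base j) * (excess false ^+ 2 - chi2) = 0.
Proof.
rewrite /base /excess /chi2 /=; move: p_gt0 p1_gt0 => p0 p1; field.
by rewrite !gt_eqF.
Qed.

Lemma increment_mean j h : \sum_b w0 b * increment j h b = 0.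
Proof.
rewrite -[RHS](@coins_weight_flip_sum _ _ base j excess (fun b => (observed j h b)%:R)).
- by apply: eq_bigr => b _; rewrite /increment (mulrC _%:R).
- exact: excess_mean.
- by move=> b; rewrite observed_flip.
Qed.

Lemma increment_ge j h b : - (1 / 2) <= increment j h b.
Proof.
rewrite /increment /excess.
have e1 : 0 <= eps / (1 - p) by rewrite divr_ge0 // ltW.
have e2 : eps / p <= 1 / 2.
  by rewrite ler_pdivrMr //; move: eps_le; lra.
by case: observed; case: (b j) => /=; lra.
Qed.

(* At most one coin is both observed and a success, while each observed coin
   succeeds with probability at least one half. *)
Lemma sum_observed h : \sum_j \sum_b w0 b * (observed j h b)%:R <= 2.
Proof.
set S := \sum_j _; suff : (1 - p) * S <= 1.
  have : 0 <= S by apply: sumr_ge0 => j _; apply: sumr_ge0 => b _; rewrite mulr_ge0.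
  by move: p_le; nra.
(* By independence, [(1 - p) * S] is the expected number of coins both observed and successful. *)
have -> : (1 - p) * S = \sum_b w0 b * \sum_j (b j && observed j h b)%:R.
  under [RHS]eq_bigr do rewrite mulr_sumr.
  rewrite exchange_big /= mulr_sumr; apply: eq_bigr => j _.
  apply/eqP; rewrite -subr_eq0 -oppr_eq0 opprB mulr_sumr -sumrB; apply/eqP.
  rewrite -[RHS](@coins_weight_flip_sum _ _ base j (fun c => c%:R - (1 - p))
     (fun b => (observed j h b)%:R)).
  - apply: eq_bigr => b _; case: (b j); case: (observed j h b) => /=; ring.
  - by rewrite /base /=; ring.
  - by move=> b; rewrite observed_flip.
rewrite -[leRHS]w0_sum; apply: ler_sum => b _.
rewrite ler_piMr //; apply: (@sum_at_most_one n R (fun j => b j && observed j h b)).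
exact: observed_success_unique.
Qed.

(** By independence each observed coin contributes [chi2] on average, and the expected number of
    observed coins is at most 2 whatever [n]. *)
Lemma sum_increment_var h : \sum_b w0 b * \sum_j increment j h b ^+ 2 <= 2 * chi2.
Proof.
have c0 : 0 <= chi2 by rewrite /chi2 divr_ge0 ?sqr_ge0 // mulr_ge0 // ltW.
suff -> : \sum_b w0 b * \sum_j increment j h b ^+ 2 =
    chi2 * \sum_j \sum_b w0 b * (observed j h b)%:R.
  by rewrite mulrC ler_wpM2r // sum_observed.
under [LHS]eq_bigr do rewrite mulr_sumr.
rewrite exchange_big mulr_sumr; apply: eq_bigr => j _.
apply/eqP; rewrite -subr_eq0 mulr_sumr -sumrB; apply/eqP.
rewrite -[RHS](@coins_weight_flip_sum _ _ base j (fun c => excess c ^+ 2 - chi2)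
   (fun b => (observed j h b)%:R)).
- by apply: eq_bigr => b _; rewrite /increment; case: (observed j h b) => /=; ring.
- exact: excess_var.
- by move=> b; rewrite observed_flip.
Qed.

(** * Likelihood ratio of the observed coins along a run *)

Fixpoint likelihood j h l : R :=
  if l is b :: l' then (1 + increment j h b) * likelihood j (step h b) l' else 1.

Fixpoint path_sum (phi : history -> coins -> R) h l : R :=
  if l is b :: l' then phi h b + path_sum phi (step h b) l' else 0.

(** [score j] is the martingale of the increments, [info j] its quadratic variation. *)
Local Notation score j := (path_sum (increment j)).
Local Notation info j := (path_sum (fun h b => increment j h b ^+ 2)).

(** The exact density is [1 + excess (b j)]. When coin [j] is unobserved the next history ignores
    it, so the excess averages out and only [increment] remains. *)
Lemma change_of_measure_step j h (G : history -> R) :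
  \sum_b w_ j b * G (step h b) = \sum_b w0 b * ((1 + increment j h b) * G (step h b)).
Proof.
apply/eqP; rewrite -subr_eq0 -sumrB; apply/eqP.
rewrite -[RHS](@coins_weight_flip_sum _ _ base j excess
   (fun b => (~~ observed j h b)%:R * G (step h b))).
- apply: eq_bigr => b _; rewrite boosted_weight /increment.
  by case: (observed j h b) => /=; ring.
- exact: excess_mean.
- move=> b; rewrite observed_flip; case: (boolP (observed j h b)) => /=.
    by rewrite !mul0r.
  by move=> /step_flip ->.
Qed.

Lemma change_of_measure j m h (F : history -> R) :
  mean (w_ j) m (fun l => F (run h l)) = mean w0 m (fun l => likelihood j h l * F (run h l)).
Proof.
elim: m h => [|m IH] h; first by rewrite !mean0 mul1r.
rewrite !meanS /=; under eq_bigr do rewrite IH.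
rewrite (change_of_measure_step _ _
  (fun h' => mean w0 m (fun l => likelihood j h' l * F (run h' l)))).
apply: eq_bigr => b _; rewrite -meanZ; congr (_ * _).
by apply: eq_mean => l _; rewrite mulrA.
Qed.

(** Each factor obeys [1 + x >= exp (x - 2 x ^ 2)] because [x >= - 1 / 2]; the product of these
    bounds is then linearized by [exp z >= 1 + z]. *)
Lemma likelihood_ge j h l : 1 + score j h l - 2 * info j h l <= likelihood j h l.
Proof.
suff : expR (score j h l - 2 * info j h l) <= likelihood j h l.
  by apply: le_trans; rewrite -addrA expR_ge1Dx.
elim: l h => [|b l IH] h /=; first by rewrite mulr0 subr0 expR0.
set x := increment j h b.
have x_ge : - (1 / 2) <= x by exact: increment_ge.
have -> : x + score j (step h b) l - 2 * (x ^+ 2 + info j (step h b) l) =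
  (x - 2 * x ^+ 2) + (score j (step h b) l - 2 * info j (step h b) l) by ring.
rewrite expRD; apply: ler_pM; rewrite ?expR_ge0 //.
(* [exp y <= 1 / (1 - y)] and [(1 + x) (1 - x + 2 x^2) = 1 + x^2 (1 + 2 x) >= 1] *)
set y := x - 2 * x ^+ 2; have e1 : (1 - y) * expR y <= 1.
  rewrite -[leRHS](@mulVf _ (expR y)) ?gt_eqF ?expR_gt0 // ler_pM2r ?expR_gt0 //.
  by rewrite -expRN expR_ge1Dx.
rewrite -(@ler_pM2l _ (1 - y)); last by rewrite /y; nra.
by apply: (le_trans e1); rewrite /y; nra.
Qed.

Lemma score_mean j m h : mean w0 m (score j h) = 0.
Proof.
elim: m h => [|m IH] h; first by rewrite mean0.
rewrite meanS -[RHS](increment_mean j h); apply: eq_bigr => b _; congr (_ * _).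
by rewrite meanD IH addr0 mean_cst.
Qed.

(** Martingale increments are orthogonal: the cross term vanishes by [score_mean] from the next
    history. *)
Lemma score_var j m h : mean w0 m (fun l => score j h l ^+ 2) = mean w0 m (info j h).
Proof.
elim: m h => [|m IH] h; first by rewrite !mean0 expr0n.
rewrite !meanS; apply: eq_bigr => b _; congr (_ * _).
set x := increment j h b.
transitivity (mean w0 m (fun l => x ^+ 2 + ((2 * x) * score j (step h b) l
    + score j (step h b) l ^+ 2))).
  by apply: eq_mean => l _ /=; rewrite -/x; ring.
by rewrite !meanD meanZ score_mean IH mulr0 add0r.
Qed.

Lemma path_sum_mean_le (phi : history -> coins -> R) c m h :
  (forall h, \sum_b w0 b * phi h b <= c) -> mean w0 m (path_sum phi h) <= c * m%:R.
Proof.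
move=> phic; elim: m h => [|m IH] h; first by rewrite mean0 mulr0.
rewrite meanS; apply: (@le_trans _ _ (\sum_b (w0 b * phi h b + w0 b * (c * m%:R)))).
  apply: ler_sum => b _; rewrite -mulrDr ler_wpM2l //.
  by rewrite meanD mean_cst // lerD2l.
by rewrite big_split /= -mulr_suml w0_sum mul1r mulrS mulrDr mulr1 lerD.
Qed.

(** The arms are summed within each round before the rounds are added, so the total does not grow
    with [n]. *)
Lemma sum_info_mean_le m h : \sum_j mean w0 m (info j h) <= 2 * chi2 * m%:R.
Proof.
rewrite -mean_sum.
rewrite (@eq_mean _ _ _ _ _ (path_sum (fun h b => \sum_j increment j h b ^+ 2) h)).
  by apply: path_sum_mean_le => h'; exact: sum_increment_var.
move=> l _; elim: l h => [|b l IH] h /=; first by rewrite big1.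
by rewrite big_split /= IH.
Qed.

(** * Numbers of pulls and expected reward *)

Lemma run_mean_le (w : coins -> R) (F : history -> R) c m h :
  (forall b, 0 <= w b) -> \sum_b w b = 1 ->
  (forall h, \sum_b w b * F (step h b) <= F h + c) ->
  mean w m (fun l => F (run h l)) <= F h + c * m%:R.
Proof.
move=> wge0 w1 Fc; elim: m h => [|m IH] h; first by rewrite mean0 mulr0 addr0.
rewrite meanS; apply: (@le_trans _ _ (\sum_b (w b * F (step h b) + w b * (c * m%:R)))).
  by apply: ler_sum => b _; rewrite -mulrDr ler_wpM2l //; exact: IH.
by rewrite big_split /= -mulr_suml w1 mul1r mulrS mulrDr mulr1 addrA lerD.
Qed.

(** Only plays without a query count; the reward of a queried round is bounded separately by 1. *)
Definition pulls (j : 'I_n) (h : history) : nat := count (fun o => o.1 == (false, j)) h.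
Definition queries (h : history) : nat := count (fun o => o.1.1) h.

Lemma sum_pulls_le h : (\sum_j pulls j h <= size h)%N.
Proof.
rewrite /pulls; elim: h => [|[[q i] r] h IH] /=; first by rewrite big1.
rewrite big_split /= -add1n leq_add //.
by rewrite (bigD1 i) //= big1 ?addn0 ?leq_b1 // => j ji;
  rewrite /eq_op /= (eq_sym i) (negPf ji) andbF.
Qed.

Lemma info_ge0 j h l : 0 <= info j h l.
Proof. by elim: l h => [|b l IH] h //=; rewrite addr_ge0 ?sqr_ge0. Qed.

Lemma pulls_le j h : (pulls j h <= size h)%N.
Proof. exact: count_size. Qed.

(** As [L >= 1 + S - 2 Q] and [0 <= Z <= T], it suffices that [S Z >= - T (1 / 8 + 2 S ^ 2)], the
    mean of [S ^ 2] being that of [Q]. *)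
Lemma boosted_mean_ge j T (Z : history -> R) :
  (forall h, size h = T -> 0 <= Z h <= T%:R) ->
  mean w0 T (fun l => Z (run [::] l)) - (T%:R / 8 + 4 * T%:R * mean w0 T (info j [::])) <=
  mean (w_ j) T (fun l => Z (run [::] l)).
Proof.
move=> Z01; rewrite change_of_measure.
set S := score j [::]; set Q := info j [::].
have -> : 4 * T%:R * mean w0 T Q =
    mean w0 T (fun l => 2 * T%:R * S l ^+ 2) + mean w0 T (fun l => 2 * T%:R * Q l).
  by rewrite !meanZ score_var; ring.
rewrite -[T%:R / 8](mean_cst w0_sum T) -!meanD -[X in _ - X]mul1r -mulNr -meanZ -meanD.
apply: le_mean => // l sl; rewrite mulN1r.
have /andP[] : 0 <= Z (run [::] l) <= T%:R by apply: Z01; rewrite size_run.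
have := likelihood_ge j [::] l; rewrite -/(S l) -/(Q l).
have := info_ge0 j [::] l; rewrite -/(Q l).
move: (likelihood j _ _) (Z _) (S l) (Q l) => L z x q q0 Lge z0 zT.
have LZ : (1 + x - 2 * q) * z <= L * z by exact: ler_wpM2r.
have Tz : 0 <= (T%:R - z) * (1 / 8 + 2 * x ^+ 2).
  by rewrite mulr_ge0 ?subr_ge0 //; have := sqr_ge0 x; lra.
(* Completing the square: [x >= - (1 / 8 + 2 x ^ 2)]. *)
have xz : 0 <= z * (2 * (x + 1 / 4) ^+ 2) by rewrite mulr_ge0 //; have := sqr_ge0 (x + 1 / 4); lra.
have qz : 0 <= (T%:R - z) * q by rewrite mulr_ge0 ?subr_ge0.
nra.
Qed.

(** Under the base law the idle counts sum to at least [(n - 1) T]. The change of measure costs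
    [n T / 8], plus at most [8 chi2 T ^ 2 <= n T / 8] of information; [n >= 2] leaves [n T / 4]. *)
Lemma sum_idle_mean_ge T : (2 <= n)%N -> 64 * (chi2 * T%:R) <= n%:R ->
  n%:R * T%:R / 4 <= \sum_j mean (w_ j) T (fun l => T%:R - (pulls j (run [::] l))%:R).
Proof.
move=> n2 chiT; have {}n2 : 2 <= n%:R :> R by rewrite ler_nat.
have T0 : 0 <= T%:R :> R by [].
pose Z j (h : history) : R := T%:R - (pulls j h)%:R.
apply: (@le_trans _ _ (\sum_j (mean w0 T (fun l => Z j (run [::] l)) -
    (T%:R / 8 + 4 * T%:R * mean w0 T (info j [::]))))); last first.
  apply: ler_sum => j _; apply: (@boosted_mean_ge j T (Z j)) => h hT.
  by rewrite /Z lerBlDr lerDl ler0n subr_ge0 ler_nat andbT -hT pulls_le.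
rewrite sumrB -mean_sum big_split /= sumr_const card_ord -mulr_sumr.
have infoT := sum_info_mean_le T [::].
have idle : (n%:R - 1) * T%:R <= mean w0 T (fun l => \sum_j Z j (run [::] l)).
  rewrite -[leLHS](mean_cst w0_sum T); apply: le_mean => // l lT.
  rewrite /Z sumrB sumr_const card_ord -[T%:R *+ n]mulr_natl mulrBl mul1r lerD2l lerN2.
  rewrite -natr_sum ler_nat -[X in (_ <= X)%N]lT.
  exact: leq_trans (sum_pulls_le _) (eq_leq (size_run _ _)).
rewrite -[T%:R / 8 *+ n]mulr_natl; move: (mean w0 T _) (\sum_j _) infoT idle => a b infoT idle.
have := ler_wpM2l T0 infoT; have := ler_wpM2l T0 chiT; nra.
Qed.

(** A played arm earns at most [1 - p + delta] on average, plus [eps] if it is [j]; a query earns at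
    most 1, whence the [p] per query. *)
Lemma total_reward_mean_le j T k :
  (forall l, size l = T -> (queries (run [::] l) <= k)%N) ->
  mean (w_ j) T (fun l => \sum_(o <- run [::] l) o.2) <=
  T%:R * (1 - p + delta) + p * k%:R + eps * mean (w_ j) T (fun l => (pulls j (run [::] l))%:R).
Proof.
(* This compensated reward has drift at most [1 - p + delta], whatever the policy does. *)
move=> qk; pose F (h : history) : R :=
  \sum_(o <- h) o.2 - eps * (pulls j h)%:R - p * (queries h)%:R.
have step_le h : \sum_b w_ j b * F (step h b) <= F h + (1 - p + delta).
  have Frcons q i r : F (rcons h (q, i, r)) =
      F h + (r - eps * ((q, i) == (false, j))%:R - p * q%:R).
    rewrite /F /pulls /queries big_rcons /= -!cats1 !count_cat /= !addn0 !natrD; ring.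
  rewrite /step /play_round; case: (policy s h) => [i|] /=.
    apply: (@le_trans _ _ (\sum_b (w_ j b * (F h + delta - eps * (i == j)%:R) +
        w_ j b * (b i)%:R))).
      apply: ler_sum => b _; rewrite -mulrDr ler_wpM2l // Frcons tnth_mktuple.
      have := arm_value_le delta_gt0 delta_le i (b i).
      rewrite {1}/eq_op /=; lra.
    rewrite big_split /= -mulr_suml wj_sum (@coins_weight_at _ _ _ i (fun c => c%:R)) /=.
    by rewrite /boosted; case: (i == j) => /=; lra.
  rewrite -[leRHS]mul1r -[X in X * _](wj_sum j) mulr_suml; apply: ler_sum => b _.
  rewrite ler_wpM2l // Frcons tnth_mktuple.
  set k' := best_arm O _ _.
  have /andP[_] : 0 <= arm_value delta k' (b k') <= 1.
    by apply: arm_value01; move: delta_gt0 delta_le; lra.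
  have -> : (true, k') == (false, j) = false by [].
  by move: delta_gt0 => /= d0; lra.
have := run_mean_le T [::] (wj_ge0 j) (wj_sum j) step_le.
have -> : F [::] = 0 by rewrite /F big_nil /= !mulr0 !subr0.
rewrite add0r mulrC -!lerBlDr; apply: le_trans.
rewrite -[p * k%:R](mean_cst (wj_sum j) T) -meanZ.
rewrite -[X in _ - X - _]mul1r -[X in _ - _ - X]mul1r -!mulNr -!meanZ -!meanD.
apply: le_mean => // l lT; rewrite /F; have : (queries (run [::] l))%:R <= k%:R :> R.
  by rewrite ler_nat qk.
move: p_gt0; nra.
Qed.

(** On average over the boosted arm, idle rounds forfeit at least a quarter of the possible gain
    [eps * T]. *)
Lemma sum_total_reward_mean_le T k : (2 <= n)%N -> 64 * (chi2 * T%:R) <= n%:R ->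
  (forall l, size l = T -> (queries (run [::] l) <= k)%N) ->
  \sum_j mean (w_ j) T (fun l => \sum_(o <- run [::] l) o.2) <=
  n%:R * (T%:R * (1 - p + delta + 3 / 4 * eps) + p * k%:R).
Proof.
move=> n2 chiT qk.
have := sum_idle_mean_ge n2 chiT; set I := \sum_j _ => Ige.
apply: (@le_trans _ _ (\sum_j ((T%:R * (1 - p + delta + eps) + p * k%:R)
   + - eps * mean (w_ j) T (fun l => T%:R - (pulls j (run [::] l))%:R)))).
  apply: ler_sum => j _; apply: (le_trans (total_reward_mean_le j qk)).
  have -> : mean (w_ j) T (fun l => T%:R - (pulls j (run [::] l))%:R) =
      T%:R - mean (w_ j) T (fun l => (pulls j (run [::] l))%:R).
    by rewrite meanD mean_cst // -[X in _ = _ - X]mul1r -mulNr -meanZ; congr (_ + _);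
      apply: eq_mean => l _; rewrite mulN1r.
  by lra.
rewrite big_split /= sumr_const card_ord -mulr_sumr -/I -mulr_natl.
by have := ler_wpM2l eps_ge0 Ige; lra.
Qed.
End fixed_seed.

(** * Averaging over the boosted arm *)

Section assembly.
Context (R : realType) (n : nat).

(* Averaging over [j], phrased through measurable minorants because the [G j]
   are not assumed measurable. *)
Lemma exists_lower_integral_le d (S : measurableType d) (mu : probability S R)
    (G : 'I_n -> S -> R) (B : R) : (0 < n)%N ->
  (forall s, \sum_j G j s <= n%:R * B) ->
  exists j, forall g : S -> R, measurable_fun setT g -> (forall s, 0 <= g s) ->
    (forall s, g s <= G j s) -> (\int[mu]_s (g s)%:E <= B%:E)%E.
Proof.
move=> n0 GB; apply: contrapT => /forallNP noj.
have /choice[g gP] : forall j, exists g : S -> R, [/\ measurable_fun setT g,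
    forall s, 0 <= g s, forall s, g s <= G j s & (B%:E < \int[mu]_s (g s)%:E)%E].
  move=> j; apply: contrapT => nog; apply: (noj j) => g mg g0 gG.
  by rewrite leNgt; apply/negP => Bg; apply: nog; exists g.
have mg j : measurable_fun setT (g j) by case: (gP j).
have g0 j s : 0 <= g j s by case: (gP j).
have gG j s : g j s <= G j s by case: (gP j).
have Bg j : (B%:E < \int[mu]_s (g j s)%:E)%E by case: (gP j).
have int0 j : (0 <= \int[mu]_s (g j s)%:E)%E.
  by apply: integral_ge0 => s _; rewrite lee_fin.
have sumB : (\sum_j \int[mu]_s (g j s)%:E <= (n%:R * B)%:E)%E.
  rewrite -ge0_integral_sum //; last 2 first.
  - by move=> j; exact/measurable_EFinP.
  - by move=> j s _; rewrite lee_fin.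
  rewrite -[leRHS]mule1 -[X in (_ * X)%E](probability_setT mu) -integral_cst //.
  apply: ge0_le_integral => //.
  - by move=> s _; apply: sume_ge0 => j _; rewrite lee_fin.
  - by apply: emeasurable_sum => j; exact/measurable_EFinP.
  - move=> s _; rewrite sumEFin lee_fin (le_trans _ (GB s)) //.
    by apply: ler_sum => j _.
(* Finiteness lets the strict bounds be added as real numbers, against the bound on the total. *)
have fin j : (\int[mu]_s (g j s)%:E \is a fin_num)%E.
  rewrite ge0_fin_numE //; apply: le_lt_trans (ltry (n%:R * B)).
  by apply: le_trans sumB; rewrite (bigD1 j) //= leeDl // sume_ge0.
pose r j := fine (\int[mu]_s (g j s)%:E)%E.
have Br j : B < r j by rewrite -lte_fin fineK.
have : \sum_j r j <= n%:R * B.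
  rewrite -lee_fin -sumEFin; apply: le_trans sumB.
  by apply: lee_sum => j _; rewrite fineK.
apply/negP; rewrite -ltNge mulr_natl -[n in B *+ n]card_ord -sumr_const.
apply: ltr_sum => //; apply/hasP; exists (Ordinal n0) => //.
Qed.

Context (delta p eps : R).
Hypothesis delta_gt0 : 0 < delta.
Hypothesis delta_le : delta <= 1 / 2.
Hypothesis p_gt0 : 0 < p.
Hypothesis p_le : p <= 1 / 2.
Hypothesis eps_ge0 : 0 <= eps.
Hypothesis eps_le : eps <= p / 2.

Let delta01 : 0 <= delta <= 1.
Proof. by move: delta_gt0 delta_le; lra. Qed.

Let q01 (j i : 'I_n) : 0 <= boosted p eps j i <= 1.
Proof. exact: boosted01. Qed.

Local Notation q j := (boosted p eps j).
Local Notation D j := (two_point_instance delta01 (q j)).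

Lemma reward_matrixE T (u : {ffun 'I_T -> {ffun 'I_n -> bool}}) :
  reward_matrix delta u = map (reward_vector delta) (codom u) :> seq (rewards R n).
Proof. by rewrite /= /codom /image_mem -map_comp. Qed.

Lemma foldl_play_round (A : learner R n) (O : oracle R n) (s : seed A) h l :
  foldl (play_round O s) h (map (reward_vector delta) l) = run O s delta h l.
Proof. by elim: l h => //= b l IH h; rewrite IH. Qed.

Lemma transcript_reward_matrix (A : learner R n) (O : oracle R n) (s : seed A) T
    (u : {ffun 'I_T -> {ffun 'I_n -> bool}}) :
  transcript O s (reward_matrix delta u) = run O s delta [::] (codom u).
Proof. by rewrite /transcript reward_matrixE foldl_play_round. Qed.

(** Without ties all oracles answer alike, so an instance chosen before the oracle serves every
    oracle. *)
Lemma run_oracle (A : learner R n) (O O' : oracle R n) (s : seed A) h l :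
  run O s delta h l = run O' s delta h l.
Proof.
elim: l h => //= b l IH h; rewrite IH; congr (run _ _ _ _ _).
rewrite /step /play_round; case: (policy s h) => // .
by rewrite (best_arm_unique delta_gt0 delta_le O _ (best_arm_max delta O' (size h) b)).
Qed.

Lemma run_rewards_ge0 (A : learner R n) (O : oracle R n) (s : seed A) l :
  0 <= \sum_(o <- run O s delta [::] l) o.2.
Proof.
suff : forall h, 0 <= \sum_(o <- h) o.2 -> 0 <= \sum_(o <- run O s delta h l) o.2.
  by apply; rewrite big_nil.
elim: l => //= b l IH h h0; apply: IH.
rewrite /step /play_round big_rcons /= addr_ge0 // tnth_mktuple.
by have /andP[] := arm_value01 delta01
  (if policy s h is Some j then j else best_arm O (size h) (reward_vector delta b))
  (b (if policy s h is Some j then j else best_arm O (size h) (reward_vector delta b))).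
Qed.

Lemma queries_run_le (A : learner R n) (O : oracle R n) (s : seed A) T k l :
  issues_at_most A T k -> size l = T -> (queries (run O s delta [::] l) <= k)%N.
Proof.
move=> Ak lT; have sz : size (map (reward_vector delta) l) == T by rewrite size_map lT.
have := Ak O s (Tuple sz); rewrite /num_queries /transcript /= foldl_play_round; apply.
move=> t i; have /mapP[b _ ->] := mem_tnth t (Tuple sz).
by rewrite tnth_mktuple arm_value01.
Qed.

Lemma coins_mean_total_reward (A : learner R n) (O : oracle R n) (s : seed A) T (w : 'I_n -> R) :
  coins_mean delta w (fun X : T.-tuple _ => total_reward O s X) =
  mean (coins_weight w) T (fun l => \sum_(o <- run O s delta [::] l) o.2).
Proof. by apply: eq_bigr => u _; rewrite /total_reward transcript_reward_matrix. Qed.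

Lemma best_arm_expectation_ge (A : learner R n) T j (t : 'I_T) :
  ((1 - p + eps - delta)%:E <=
   'E_(joint_law A (D j) T)[fun w => tnth (tnth w.2 t) j])%E.
Proof.
rewrite expectation_joint_law //; last 2 first.
- apply: (measurableT_comp (measurable_tnth j)).
  by apply: (measurableT_comp (measurable_tnth t)).
- move=> s u; rewrite !tnth_mktuple; by have /andP[] := arm_value01 delta01 j (u t j).
rewrite (eq_integral (cst ((q j j * arm_value delta j true +
    (1 - q j j) * arm_value delta j false)%:E))); last first.
  move=> s _; rewrite /coins_mean; congr _%:E.
  under eq_bigr do rewrite !tnth_mktuple.
  rewrite (sum_prod_at (w := fun=> coins_weight (q j)) t
    (fun b : {ffun 'I_n -> bool} => arm_value delta j (b j))).
    by rewrite coins_weight_at.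
  by move=> _; exact: coins_weight_sum.
rewrite integral_cst // [X in (_ * X)%E]probability_setT mule1 lee_fin.
have /andP[_] := q01 j j; rewrite {2}/boosted.
have /andP[v0 _] := arm_value01 delta01 j false.
have -> : arm_value delta j true = arm_value delta j false + (1 - delta).
  by rewrite /arm_value /=; ring.
rewrite /boosted eqxx mul1r => q1.
have := delta_gt0; nra.
Qed.

Lemma exists_bad_instance (T k : nat) (A : learner R n) :
  (2 <= n)%N -> 64 * (chi2 p eps * T%:R) <= n%:R -> issues_at_most A T k ->
  exists D : instance R n, forall O : oracle R n,
    ((T%:R * (eps / 4 - 2 * delta) - p * k%:R)%:E <= regret A O D T)%E.
Proof.
move=> n2 chiT Ak; have n0 : (0 < n)%N by exact: leq_trans n2.
(* The boosted arm is selected by running against one fixed oracle; if there is none, the claim is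
   vacuous. *)
have [ [ O0 ] |noO] := pselect (inhabited (oracle R n)); last first.
  by exists (D (Ordinal n0)) => O; case: noO.
set B := T%:R * (1 - p + delta + 3 / 4 * eps) + p * k%:R.
have [j jB] := exists_lower_integral_le (seed_law A) n0 (fun s =>
  sum_total_reward_mean_le (s := s) (O := O0) delta_gt0 delta_le p_gt0 p_le
    eps_ge0 eps_le n2 chiT (fun l => queries_run_le O0 s Ak)).
exists (D j) => O; rewrite /regret.
have reward_le : ('E_(joint_law A (D j) T)[fun w => total_reward O w.1 w.2] <= B%:E)%E.
  apply: expectation_joint_law_le => //.
    by move=> s u; rewrite /total_reward transcript_reward_matrix; exact: run_rewards_ge0.
  move=> g mg g0 gle; apply: jB => // s; apply: (le_trans (gle s)).
  rewrite coins_mean_total_reward (@eq_mean _ _ _ _ _ (fun l =>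
    \sum_(o <- run O0 s delta [::] l) o.2)) // => l _.
  by rewrite (run_oracle O O0).
have best_ge : ((T%:R * (1 - p + eps - delta))%:E <=
    \big[maxe/-oo]_(i < n) (\sum_(t < T) 'E_(joint_law A (D j) T)[fun w => tnth (tnth w.2 t) i]))%E.
  apply: le_trans (le_bigmax _ _ j).
  rewrite mulr_natl -[T in _ *+ T]card_ord -sumr_const -sumEFin.
  by apply: lee_sum => t _; exact: best_arm_expectation_ge.
apply: le_trans (leeB best_ge reward_le).
by rewrite -EFinB lee_fin /B; lra.
Qed.

End assembly.

(** * Choice of [p] and [eps], and conclusion *)

Lemma exists_parameters (R : realType) (N t kappa : R) :
  2 <= N -> N <= t -> 1 <= kappa -> 32 * kappa <= t ->
  exists p eps : R,
  [/\ 0 < p <= 1 / 2, 0 < eps <= p / 2, 64 * (chi2 p eps * t) <= N,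
      p * kappa <= eps * t / 16 &
      (1 / 32) ^+ 3 * Num.min (t * N / kappa) (Num.sqrt (N * (t - kappa))) <= eps * t / 8].
Proof.
move=> N2 Nt k1 kt.
have N0 : 0 < N by lra.
have t0 : 0 < t by lra.
have k0 : 0 < kappa by lra.
have Nt0 : 0 < N * t by exact: mulr_gt0.
have K0 : 0 < (256 * kappa) ^+ 2 by rewrite exprn_gt0 // mulr_gt0.
(* For the [eps] below, [p * kappa <= eps * t / 16] amounts, after squaring, to [p <= r]. *)
pose r := N * t / (256 * kappa) ^+ 2; pose p := Num.min (1 / 2) r.
have r0 : 0 < r by rewrite divr_gt0.
have p0 : 0 < p by rewrite /p lt_min r0 andbT; lra.
have p1 : p <= 1 / 2 by rewrite /p ge_min lexx.
have rK : r * (256 * kappa) ^+ 2 = N * t by rewrite divfK ?gt_eqF.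
have pK : p * (256 * kappa) ^+ 2 <= N * t.
  by rewrite -rK ler_wpM2r ?(ltW K0) // ge_min lexx orbT.
(* This size makes [64 * (chi2 p eps * t)] equal to [N / (4 * (1 - p))], at most [N / 2] since
   [p <= 1 / 2]. *)
pose eps := Num.sqrt (p * N / t) / 16.
have eps0 : 0 < eps by rewrite divr_gt0 // sqrtr_gt0 divr_gt0 // mulr_gt0.
have eps2 : eps ^+ 2 * t = p * N / 256.
  rewrite expr_div_n sqr_sqrtr; last by rewrite ltW // divr_gt0 // mulr_gt0.
  by field; rewrite gt_eqF.
(* Equivalent to [eps <= p / 2]. When [p = r] it reads [(32 * kappa) ^ 2 <= t ^ 2], the origin of
   the constant [C = 32]. *)
have Npt : N <= 64 * (p * t).
  have k2 : 1024 * kappa ^+ 2 <= t ^+ 2 by nra.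
  rewrite /p minEle; case: ifP => _; first by lra.
  rewrite -(ler_pM2r K0); have -> : 64 * (r * t) * (256 * kappa) ^+ 2 =
    64 * t * (r * (256 * kappa) ^+ 2) by ring.
  by rewrite rK; have := ler_wpM2l (ltW N0) k2; nra.
have le_sq (x y : R) : 0 <= y -> x ^+ 2 <= y ^+ 2 -> x <= y.
  by move=> y0 xy; rewrite leNgt; apply/negP => yx; nra.
have et2 : (eps * t) ^+ 2 = p * (N * t) / 256.
  by rewrite exprMn [t ^+ 2]expr2 mulrA eps2; ring.
exists p, eps; split.
- by rewrite p0.
- rewrite eps0 /=; apply: le_sq; first by lra.
  rewrite -(ler_pM2r t0) eps2; have := ler_wpM2l (ltW p0) Npt; nra.
- have -> : 64 * (chi2 p eps * t) = N / (4 * (1 - p)).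
    have -> : chi2 p eps * t = eps ^+ 2 * t / (p * (1 - p)) by rewrite /chi2; ring.
    by rewrite eps2; field; rewrite !gt_eqF //; lra.
  by rewrite ler_pdivrMr; nra.
- apply: le_sq; first by rewrite divr_ge0 // mulr_ge0 // ltW.
  rewrite expr_div_n et2; have := ler_wpM2l (ltW p0) pK; nra.
- have et0 : 0 <= eps * t by rewrite mulr_ge0 // ltW.
  (* [p = 1 / 2] is matched with the square root and [p = r] with [t * N / kappa]; the latter is an
     equality and fixes the constant [(1 / 32) ^+ 3]. *)
  move: et2; rewrite /p minEle; case: ifP => _ et2.
    apply: (@le_trans _ _ ((1 / 32) ^+ 3 * Num.sqrt (N * (t - kappa)))).
      by rewrite ler_wpM2l // ?ge_min ?lexx ?orbT.
    apply: le_sq; first by lra.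
    rewrite exprMn sqr_sqrtr; last by rewrite mulr_ge0 //; lra.
    by rewrite [(eps * t / 8) ^+ 2]expr_div_n et2; nra.
  apply: (@le_trans _ _ ((1 / 32) ^+ 3 * (t * N / kappa))).
    by rewrite ler_wpM2l // ?ge_min ?lexx.
  apply: le_sq; first by lra.
  rewrite [(eps * t / 8) ^+ 2]expr_div_n et2 -rK le_eqVlt; apply/orP; left; apply/eqP.
  have -> : r * (r * (256 * kappa) ^+ 2) = (N * t) ^+ 2 / (256 * kappa) ^+ 2.
    by rewrite rK /r; field; rewrite gt_eqF.
  by field; rewrite gt_eqF.
Qed.

Theorem theorem4p6 (R : realType) :
  exists C c : R, 0 < C /\ 0 < c /\
  forall n T k : nat, (2 <= n)%N -> (n <= T)%N -> (1 <= k <= T)%N ->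
  k%:R <= T%:R / C ->
  forall A : learner R n, issues_at_most A T k ->
  exists D : instance R n, forall O : oracle R n,
    ((c * Num.min (T%:R * n%:R / k%:R)
                  (Num.sqrt (n%:R * (T%:R - k%:R))))%:E
     <= regret A O D T)%E.
Proof.
exists 32, ((1 / 32) ^+ 3); split; first by lra.
split; first by rewrite exprn_gt0 // divr_gt0.
move=> n T k n2 nT /andP[k1 _] kT A Ak.
have [||||p [eps [/andP[p0 p1] /andP[e0 e1] chiT pk cmin]]] :=
  @exists_parameters R n%:R T%:R k%:R; rewrite ?ler_nat ?ler1n //.
  by rewrite mulrC -ler_pdivlMr.
(* With [delta = eps / 32], the bonuses cost [eps * T / 16] and the queries at most as much, out of
   [eps * T / 4]; at least [eps * T / 8] remains. *)
have d0 : 0 < eps / 32 by rewrite divr_gt0.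
have d1 : eps / 32 <= 1 / 2 by lra.
have [D DP] := exists_bad_instance d0 d1 p0 p1 (ltW e0) e1 n2 chiT Ak.
exists D => O; apply: le_trans (DP O); rewrite lee_fin; lra.
Qed.
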